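(* For any tree $T$ with at least two vertices, $Z(T) \le Z(L(T))$.
   Context: All graphs are finite and simple. $L(T)$ is the line graph of $T$ (vertex set $E(T)$, two vertices adjacent iff the edges share an endpoint). Zero forcing: each vertex of a graph $H$ is colored black or white; if a black vertex $u$ has exactly one white neighbor $w$, then $w$ becomes black (color-change rule). $S \subseteq V(H)$ is a zero forcing set if, starting with exactly $S$ black, repeated application of the rule makes every vertex black. $Z(H)$ is the minimum size of a zero forcing set of $H$. *)

(* Defs.v *)
From mathcomp Require Import all_boot.

Set Implicit Arguments.
Unset Strict Implicit.
Unset Printing Implicit Defensive.

Record sgraph := SGraph {
  vertex :> finType;
  adj : rel vertex;
  adj_sym : symmetric adj;
  adj_irr : irreflexive adj
}.

Definition edges (G : sgraph) : {set {set G}} :=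
  [set e : {set G} | [exists x, exists y, adj x y && (e == [set x; y])]].

Definition connected (G : sgraph) : Prop :=
  0 < #|G| /\ forall x y : G, connect (@adj G) x y.

(* A cyclic sequence of length 2 only traverses one edge back and forth, so
   the cycles of a simple graph are the duplicate-free ones of length >= 3. *)
Definition acyclic (G : sgraph) : Prop :=
  forall c : seq G, 3 <= size c -> ~ ucycle (@adj G) c.

Definition is_tree (G : sgraph) : Prop := connected G /\ acyclic G.

Section LineGraph.
Variable G : sgraph.

Definition line_vertex : finType := {e : {set G} | e \in edges G}.

Definition line_adj : rel line_vertex :=
  fun e f => (e != f) && (val e :&: val f != set0).

Lemma line_adj_sym : symmetric line_adj.
Proof. by move=> e f; rewrite /line_adj eq_sym setIC. Qed.

Lemma line_adj_irr : irreflexive line_adj.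
Proof. by move=> e; rewrite /line_adj eqxx. Qed.

Definition line_graph : sgraph := SGraph line_adj_sym line_adj_irr.

End LineGraph.

Section ZeroForcing.
Variable G : sgraph.

(* A colouring is represented by its set B of black vertices. *)
Definition forces (B : {set G}) (u w : G) : bool :=
  (u \in B) && ([set v | adj u v & v \notin B] == [set w]).

Definition color_change : rel {set G} :=
  fun B B' => [exists u, exists w, forces B u w && (B' == w |: B)].

Definition zero_forcing (S : {set G}) : bool :=
  connect color_change S [set: G].

Lemma zero_forcing_setT : zero_forcing [set: G].
Proof. exact: connect0. Qed.

(* By zero_forcing_setT the default of the arg min is admissible. *)
Definition zero_forcing_number : nat :=
  #|[arg min_(S < [set: G] | zero_forcing S) #|S| ]|.

Lemma zero_forcing_numberP :
  (exists2 S, zero_forcing S & #|S| = zero_forcing_number) /\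
  (forall S, zero_forcing S -> zero_forcing_number <= #|S|).
Proof.
rewrite /zero_forcing_number; case: arg_minnP; first exact: zero_forcing_setT.
by move=> S zS minS; split; [exists S | exact: minS].
Qed.

End ZeroForcing.

(* Main.v *)
Require Import Defs.
From mathcomp Require Import all_boot.

(** Fix a zero forcing set S of the line graph and let [phi g] be the edge that
    forces g, for each edge g outside S.  The edges at a vertex v form a
    clique, so at most one force takes place at v; hence the forcing chains are
    edge-disjoint paths of T no two of which have a common interior vertex.
    Letting every vertex keep only one of the chains through it (the one of
    which it is interior, if there is one) covers T by at most #|S|
    vertex-disjoint paths.  Finally, in an acyclic graph the starting points of
    such a path cover always form a zero forcing set: if the process got stuck,
    going backwards along the paths from white vertices, and from the last black
    vertex of a path to another white neighbour, would give an endless walk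
    that never backtracks. *)

(** A step back to an earlier vertex would close a cycle of length at least 3, so the walk yields
    duplicate-free paths of every length, listed here latest vertex first; one of them outgrows
    [#|G|]. *)
Lemma acyclic_no_endless_walk (G : sgraph) (I : rel G) (a b : G) :
  acyclic G ->
  (forall x y, I x y -> adj x y) ->
  (forall x y, I x y -> exists2 z, I y z & z != x) ->
  ~ I a b.
Proof.
move=> acG I_adj I_next Iab.
have adj_neq (x y : G) : adj x y -> x != y.
  by apply: contraTneq => ->; rewrite adj_irr.
have long n : exists x y s,
    [/\ size s = n, uniq [:: y, x & s], path (@adj G) y (x :: s) & I x y].
  elim: n => [|n [x [y [s [sz_s uniq_s path_s Ixy]]]]].
    exists a, b, [::]; have := I_adj _ _ Iab => adj_ab; split=> //=.
      by rewrite inE andbT eq_sym adj_neq.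
    by rewrite adj_sym adj_ab.
  have [z Iyz z'x] := I_next _ _ Ixy; have adj_yz := I_adj _ _ Iyz.
  exists y, z, (x :: s); split; rewrite ?[size _]/= ?sz_s //; last first.
    by rewrite [path _ _ _]/= adj_sym adj_yz.
  rewrite cons_uniq uniq_s andbT !inE !negb_or z'x eq_sym adj_neq //=.
  apply/negP=> zs; move: path_s uniq_s; case/splitPr: zs {sz_s} => s1 s2.
  rewrite -cat_rcons -!cat_cons cat_path cat_uniq => /andP[path_s _] /andP[uniq_s _].
  apply: (acG [:: y, x & rcons s1 z]); first by rewrite /= size_rcons.
  by rewrite /ucycle uniq_s andbT (cycle_path y) /= last_rcons adj_sym adj_yz.
have [x [y [s [sz_s uniq_s _ _]]]] := long #|G|.
by have := max_card [in [:: y, x & s]]; rewrite (card_uniqP uniq_s) /= sz_s ltnNge leqnSn.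
Qed.

Lemma forces_white {G : sgraph} {B : {set G}} {u w : G} :
  forces B u w -> adj u w && (w \notin B).
Proof. by case/andP=> _ /eqP/setP/(_ w); rewrite !inE eqxx. Qed.

(** A largest set reachable from [S] admits no further force. *)
Lemma zero_forcing_stuck (G : sgraph) (S : {set G}) :
  (forall B : {set G}, S \subset B -> (forall u w, ~~ forces B u w) ->
     B = [set: G]) ->
  zero_forcing S.
Proof.
pose reach (B : {set G}) := connect (@color_change G) S B && (S \subset B).
have reachS : reach S by rewrite /reach connect0 subxx.
move=> stuckT; case: (@arg_maxnP _ S reach (fun B => #|B|) reachS).
move=> B /andP[connSB sSB] maxB; rewrite /zero_forcing -(stuckT B) // => u w.
apply/negP=> fuw; have /andP[_ wB] := forces_white fuw.
have /maxB : reach (w |: B).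
  rewrite /reach (subset_trans sSB (subsetUr _ _)) andbT.
  apply: connect_trans connSB (connect1 _).
  by apply/existsP; exists u; apply/existsP; exists w; rewrite fuw eqxx.
by rewrite cardsU1 wB add1n /= leqNgt leqnn.
Qed.

(** [P u w] says that w follows u on one of the paths of the cover. *)
Lemma path_starts_zero_forcing (G : sgraph) (P : rel G) :
  acyclic G ->
  (forall u w, P u w -> adj u w) ->
  (forall u w w', P u w -> P u w' -> w = w') ->
  (forall u w, P u w -> ~~ P w u) ->
  zero_forcing [set w | ~~ [exists u, P u w]].
Proof.
move=> acG P_adj P_inj P_asym; apply: zero_forcing_stuck => B sSB stuck.
apply/setP=> b0; rewrite inE; apply/negPn/negP => white_b0.
have pred b : b \notin B -> exists c, P c b.
  by move=> /(contra (subsetP sSB b)); rewrite inE negbK => /existsP.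
(* Steps that can be continued: a black [b] is entered backwards from its white path successor [a];
   a white [b] has a path predecessor other than [a]. *)
pose I := [rel a b | adj a b &&
  if b \in B then (a \notin B) && P b a else [exists c, P c b && (c != a)]].
have I_pred b c : b \notin B -> P c b -> I b c.
  move=> white_b Pcb; rewrite /= adj_sym P_adj //= Pcb white_b.
  case: ifPn => // /pred[d Pdc]; apply/existsP; exists d; rewrite Pdc.
  by apply: contraTneq Pdc => ->; apply: P_asym.
have [c0 Pc0] := pred _ white_b0.
apply: (@acyclic_no_endless_walk G I b0 c0) => // [x y /andP[]//|a b|].
  2: exact: I_pred.
case/andP=> adj_ab; case: ifPn => [Bb /andP[white_a Pba]|white_b].
  (* Black [b] does not force [a], so it has a second white neighbour [c]. The predecessor of [c] is
     not [b], whose only successor is [a]. *)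
  have [c [adj_bc white_c c'a]] : exists c, [/\ adj b c, c \notin B & c != a].
    have [c|nbrs] := pickP [pred c | [&& adj b c, c \notin B & c != a]].
      by case/and3P; exists c.
    case/negP: (stuck b a); rewrite /forces Bb; apply/eqP/setP=> c; rewrite !inE.
    apply/idP/eqP=> [/andP[adj_bc white_c]|->]; last by rewrite adj_sym adj_ab.
    by apply/eqP; have := nbrs c; rewrite /= adj_bc white_c => /negbFE.
  exists c => //; rewrite /= adj_bc (negPf white_c).
  have [d Pdc] := pred _ white_c; apply/existsP; exists d; rewrite Pdc /=.
  by apply: contraNneq c'a => def_d; rewrite (P_inj b c a) // -def_d.
by case/existsP=> c /andP[Pcb c'a]; exists c => //; apply: I_pred.
Qed.

(** The second property is all that is kept of the order of the forces: if [w] is forced before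
    [w'], then [w'] is still white at that time, hence outside the closed neighbourhood of
    [phi w]. *)
Lemma zero_forcing_forcers (G : sgraph) (S : {set G}) :
  zero_forcing S ->
  exists phi : G -> G,
    (forall w, w \notin S -> adj (phi w) w) /\
    (forall w w', w \notin S -> w' \notin S -> w != w' ->
       ~~ adj (phi w) w' && (w' != phi w) || ~~ adj (phi w') w && (w != phi w')).
Proof.
pose forced (B : {set G}) (phi : G -> G) :=
  [/\ S \subset B,
      forall w, w \in B :\: S ->
        [/\ adj (phi w) w, phi w \in B & forall v, adj (phi w) v -> v \in B] &
      forall w w', w \in B :\: S -> w' \in B :\: S -> w != w' ->
       ~~ adj (phi w) w' && (w' != phi w) || ~~ adj (phi w') w && (w != phi w')].
suff H (B : {set G}) : connect (@color_change G) S B -> exists phi, forced B phi.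
  move=> /H[phi [_ phi1 phi2]]; exists phi.
  split=> [w wS | w w' wS w'S]; first by case: (phi1 w); rewrite // !inE wS.
  by apply: phi2; rewrite !inE ?wS ?w'S.
case/connectP=> p; elim/last_ind: p B => [|p B IHp] B'.
  move=> _ ->; exists id; split=> // w; rewrite setDv inE //.
rewrite rcons_path last_rcons => /andP[/IHp IH step] ->.
have {IH}[phi [sSB phi1 phi2]] := IH _ erefl.
move: (last S p) step sSB phi1 phi2 => C /existsP[u /existsP[w0 /andP[fuw /eqP->]]].
move=> sSC phi1 phi2; have /andP[adj_uw0 w0C] := forces_white fuw.
case/andP: fuw => uC /eqP white_u.
exists (fun w => if w == w0 then u else phi w); split.
- exact: subset_trans sSC (subsetUr _ _).
- move=> w; rewrite !inE => /andP[wS]; case: eqP => [-> _|_ /= wC].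
    split=> // [|v adj_uv]; first by rewrite uC orbT.
    rewrite !inE; have /setP/(_ v) := white_u; rewrite !inE adj_uv /= => <-.
    by case: (v \in C).
  have [] := phi1 w; rewrite ?inE ?wS // => -> -> nbrs; rewrite orbT; split=> // v /nbrs.
  by rewrite !inE orbC => ->.
(* [w0] is white in [C], while the closed neighbourhood of each earlier forcer is already black. *)
have old w : w \in C :\: S -> ~~ adj (phi w) w0 && (w0 != phi w).
  move=> /phi1[_ Cphi nbrs]; apply/andP; split; first exact: contra (nbrs _) w0C.
  by apply: contraNneq w0C => ->.
move=> w w'; rewrite !inE.
case: eqP => [->|_] /= /andP[wS wC] /andP[w'S]; case: eqP => [->|_] //=.
- by rewrite eqxx.
- by move=> w'C _; rewrite (old w') ?orbT // !inE w'S.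
- by move=> _ _; rewrite (old w) // !inE wS.
by move=> w'C; apply: phi2; rewrite !inE ?wS ?w'S.
Qed.

Lemma line_vertex_end (G : sgraph) (e : line_graph G) (v : G) :
  v \in val e -> exists2 u, adj v u & val e = [set v; u].
Proof.
have /[!inE] /existsP[x /existsP[y /andP[adj_xy /eqP->]]] := valP e.
rewrite !inE => /orP[] /eqP->; first by exists y.
by exists x; rewrite 1?adj_sym // setUC.
Qed.

Lemma line_vertex_nonempty (G : sgraph) (e : line_graph G) :
  exists v, v \in val e.
Proof.
have /[!inE] /existsP[x /existsP[y /andP[_ /eqP->]]] := valP e.
by exists x; rewrite !inE eqxx.
Qed.

Lemma line_adj_common (G : sgraph) (e f : line_graph G) (v : G) :
  v \in val e -> v \in val f -> e != f -> adj e f.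
Proof.
move=> ve vf; rewrite /= /line_adj => ->.
by apply/set0Pn; exists v; rewrite inE ve.
Qed.

(** The forcing chains orient the edges: [tl g] is the vertex that g shares with
    the edge [phi g] forcing it. *)
Lemma line_zero_forcing_orientation (G : sgraph) (S : {set line_graph G}) :
  zero_forcing S ->
  exists (phi : line_graph G -> line_graph G) (tl hd : line_graph G -> G),
    [/\ forall e, adj (tl e) (hd e) /\ val e = [set tl e; hd e],
        forall g, g \notin S -> hd (phi g) = tl g &
        forall g h, g \notin S -> h \notin S -> tl g = tl h -> g = h].
Proof.
move=> /zero_forcing_forcers[phi [phi_adj phi_sep]].
have /fin_all_exists[t tP] (g : line_graph G) : exists v,
    g \notin S -> v \in val g /\ v \in val (phi g).
  have [Sg|/phi_adj/andP[_ /set0Pn[v]]] := boolP (g \in S).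
    by have [v _] := line_vertex_nonempty _ g; exists v.
  by rewrite inE => /andP[]; exists v.
(* Otherwise each of [g] and [h] would meet the forcer of the other, against [phi_sep]. *)
have t_inj g h : g \notin S -> h \notin S -> t g = t h -> g = h.
  move=> gS hS eq_t; apply/eqP/negPn/negP => g'h.
  have [[tg tpg] [th tph]] := (tP g gS, tP h hS).
  case/orP: (phi_sep g h gS hS g'h) => /andP[/negP nadj neq]; case: nadj.
    by apply: line_adj_common tpg _ _; rewrite 1?eq_sym // eq_t.
  by apply: line_adj_common tph _ _; rewrite 1?eq_sym // -eq_t.
have phi_inj g h : g \notin S -> h \notin S -> phi g = phi h -> g = h.
  move=> gS hS eq_phi; apply/eqP/negPn/negP => g'h.
  case/orP: (phi_sep g h gS hS g'h) => /andP[/negP nadj _]; case: nadj.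
    by rewrite eq_phi phi_adj.
  by rewrite -eq_phi phi_adj.
(* [p] gives tail and head. If [g] is forced and forces [h], then [t g] and [t h] differ: by [t_inj]
   equality would make [g] force itself. *)
have /fin_all_exists[p pP] (g : line_graph G) : exists p : G * G,
    [/\ adj p.1 p.2, val g = [set p.1; p.2], g \notin S -> p.1 = t g &
        forall h, h \notin S -> phi h = g -> p.2 = t h].
  have [h /andP[hS /eqP def_g]|no_h] :=
      pickP [pred h | (h \notin S) && (phi h == g)].
    have [_ th] := tP h hS; rewrite def_g in th.
    have [u adj_u val_g] := line_vertex_end _ _ _ th.
    exists (u, t h); split=> //=; first by rewrite adj_sym.
    - by rewrite setUC.
    - move=> gS; have [+ _] := tP g gS; rewrite val_g !inE => /orP[]/eqP // eq_t.
      by have := phi_adj h hS; rewrite def_g (t_inj g h) // adj_irr.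
    by move=> h' h'S /esym; rewrite -def_g => /phi_inj->.
  have [v vg v_t] : exists2 v, v \in val g & g \notin S -> v = t g.
    have [Sg|gS] := boolP (g \in S); last by exists (t g) => //; case: (tP g gS).
    by have [v vg] := line_vertex_nonempty _ g; exists v.
  have [u adj_u val_g] := line_vertex_end _ _ _ vg.
  exists (v, u); split=> //= h hS def_g.
  by have := no_h h; rewrite /= hS def_g eqxx.
exists phi, (fun g => (p g).1), (fun g => (p g).2); split=> [e|g gS|g h gS hS].
- by case: (pP e).
- by case: (pP (phi g)) => _ _ _ /(_ g gS erefl)->; case: (pP g) => _ _ ->.
by case: (pP g) => _ _ -> // _; case: (pP h) => _ _ -> // _; apply: t_inj.
Qed.

Lemma connected_incident_edge (G : sgraph) (v : G) :
  connected G -> 2 <= #|G| -> exists e : line_graph G, v \in val e.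
Proof.
move=> [_ connG] G_gt1; have [w w'v] : exists w, w != v.
  have: 0 < #|predC1 v| by rewrite cardC1 -ltnS prednK // ltnW.
  by case/card_gt0P=> w; exists w.
case/connectP: (connG v w) w'v => [[|x p]] /= => [_ ->|/andP[adj_vx _] _ _].
  by rewrite eqxx.
suff vx : [set v; x] \in edges G by exists (exist (fun e => e \in edges G) _ vx); rewrite !inE eqxx.
by rewrite inE; apply/existsP; exists v; apply/existsP; exists x; rewrite adj_vx eqxx.
Qed.

Theorem theorem3p13 (T : sgraph) (hT : is_tree T) (hcard : 2 <= #|T|) :
  zero_forcing_number T <= zero_forcing_number (line_graph T).
Proof.
have [connT acT] := hT.
have [[S zfS <-] _] := zero_forcing_numberP (line_graph T).
have [_ minT] := zero_forcing_numberP T.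
have [phi [tl [hd [ends hd_phi tl_inj]]]] := line_zero_forcing_orientation _ _ zfS.
have tl'hd e : tl e != hd e.
  by have [+ _] := ends e; apply: contraTneq => ->; rewrite adj_irr.
(* [own v] is the edge whose chain keeps v. *)
have /fin_all_exists[own ownP] (v : T) : exists e : line_graph T,
    v \in val e /\ forall g, g \notin S -> tl g = v -> e = phi g.
  have [g /andP[gS /eqP tl_g]|no_g] :=
      pickP [pred g | (g \notin S) && (tl g == v)].
    exists (phi g); split; last by move=> h hS tl_h; rewrite (tl_inj g h) // tl_h.
    by rewrite (ends _).2 hd_phi // tl_g !inE eqxx orbT.
  have [e ve] := connected_incident_edge T v connT hcard.
  by exists e; split=> // g gS tl_g; have := no_g g; rewrite /= gS tl_g eqxx.
have own_tl g : g \notin S -> own (tl g) = phi g.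
  by move=> gS; case: (ownP (tl g)) => _; apply.
(* The chain of [own w] must also keep [u]. If [own w] is forced this is automatic, as [own u] is
   then [phi (own w)]; otherwise [own w] begins its chain and must itself be [own u]. *)
pose P := [rel u w | [&& hd (own w) == w, tl (own w) == u &
                         (own w \notin S) || (own u == own w)]].
have P_adj u w : P u w -> adj u w.
  by case/and3P=> /eqP hd_w /eqP tl_w _; rewrite -tl_w -{2}hd_w; case: (ends (own w)).
have own_hd u w : tl (own w) = u -> own w \notin S -> hd (own u) = u.
  by move=> <- wS; rewrite own_tl // hd_phi.
have P_inj u w w' : P u w -> P u w' -> w = w'.
  case/and3P=> /eqP hd_w /eqP tl_w Sw /and3P[/eqP hd_w' /eqP tl_w' Sw'].
  suff: own w = own w' by rewrite -{2}hd_w -{2}hd_w' => ->.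
  have not_tl : tl (own u) = u -> hd (own u) != u.
    by move=> tl_u; rewrite -{2}tl_u eq_sym.
  (* If [own w] is forced, [u] is the head of [own u]; if [own u = own w], it is the tail. This
     excludes the mixed cases. *)
  case/orP: Sw => [wS|/eqP own_w]; case/orP: Sw' => [w'S|/eqP own_w'].
  - by apply: tl_inj => //; rewrite tl_w.
  - by case/eqP: (not_tl (etrans (congr1 tl own_w') tl_w')); apply: own_hd tl_w wS.
  - by case/eqP: (not_tl (etrans (congr1 tl own_w) tl_w)); apply: own_hd tl_w' w'S.
  by rewrite -own_w.
have P_asym u w : P u w -> ~~ P w u.
  case/and3P=> /eqP hd_w /eqP tl_w _; apply/and3P=> -[/eqP hd_u /eqP tl_u _].
  have own_uw : own u = own w.
    by apply: val_inj; rewrite (ends _).2 hd_u tl_u (ends _).2 hd_w tl_w setUC.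
  by have := tl'hd (own u); rewrite {1}own_uw tl_w hd_u eqxx.
apply: leq_trans (minT _ (path_starts_zero_forcing T P acT P_adj P_inj P_asym)) _.
(* The first edge of a chain determines the first vertex that the chain keeps. *)
pose start e := if own (tl e) == e then tl e else hd e.
apply: leq_trans (leq_imset_card start [in S]); apply/subset_leq_card/subsetP=> w.
rewrite inE => /existsPn no_pred.
(* Whether [w] is tail or head of [own w], that edge lies in [S] and [start] maps it to [w]. Were
   [w] its tail and the edge forced, [own_hd] would make [w] its head too. *)
have [+ _] := ownP w; rewrite (ends _).2 !inE => /orP[]/eqP def_w.
  apply/imsetP; exists (own w); last by rewrite /start -def_w eqxx.
  apply/negPn/negP=> wS; have := tl'hd (own w).
  by rewrite -def_w (own_hd w w) ?eqxx.
have := no_pred (tl (own w)); rewrite /= -def_w !eqxx /= negb_or negbK.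
case/andP=> Sw own_w; apply/imsetP; exists (own w) => //.
by rewrite /start (negPf own_w).
Qed.
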